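(* Let $p$ be an odd prime, $q$ a power of $p$, and $k$ an integer with $0\le k\le p-1$. For an integer $n\ge 0$, the polynomial $D_{n,k}(0,x)\in\mathbb{F}_q[x]$ is a permutation polynomial of $\mathbb{F}_q$ if and only if $k\neq 2$ and $n=2l$ for some integer $l$ with $\gcd(l,q-1)=1$.
   Context: For $a\in\mathbb{F}_q$ and integer $n\ge 1$, the $n$-th reversed Dickson polynomial of the $(k+1)$-th kind is $D_{n,k}(a,x)=\sum_{i=0}^{\lfloor n/2\rfloor}\frac{n-ki}{n-i}\binom{n-i}{i}(-x)^i a^{n-2i}\in\mathbb{F}_q[x]$ (the rational numbers $\frac{n-ki}{n-i}\binom{n-i}{i}$ are integers, reduced mod $p$; $a^0=1$), and $D_{0,k}(a,x)=2-k$. A polynomial $f\in\mathbb{F}_q[x]$ is a permutation polynomial (PP) of $\mathbb{F}_q$ if $x\mapsto f(x)$ is a bijection of $\mathbb{F}_q$. *)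

(* Defs.v *)
From mathcomp Require Import all_boot all_order all_algebra.
From mathcomp Require Import zify.

Set Implicit Arguments.
Unset Strict Implicit.
Unset Printing Implicit Defensive.

Import Order.TTheory GRing.Theory Num.Theory.
Local Open Scope ring_scope.

Definition rdickson_coef (n : nat) (k : int) (i : nat) : rat :=
  (n%:Z - k * i%:Z)%:~R / (n%:Z - i%:Z)%:~R * 'C(n - i, i)%:R.

Lemma rdickson_coef_int (n : nat) (k : int) (i : nat) :
  (0 < n)%N -> (i <= n./2)%N -> rdickson_coef n k i \is a Num.int.
Proof.
move=> n_gt0 le_in; rewrite /rdickson_coef.
have lt_in : (i < n)%N by lia.
case: i le_in lt_in => [|i] le_in lt_in.
  by rewrite bin0 mulr0 !subr0 mulr1 divff ?intr1 // intr_eq0; lia.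
pose m := (n - i.+2)%N.
have -> : (n - i.+1 = m.+1)%N by rewrite /m; lia.
have -> : n%:Z - i.+1%:Z = m.+1%:Z by rewrite /m; lia.
have binE : i.+1%:Q * 'C(m.+1, i.+1)%:Q = m.+1%:Q * 'C(m, i)%:Q.
  by rewrite -!intrM -!PoszM mul_bin_diag.
have nz_m : m.+1%:Q != 0 by rewrite intr_eq0.
suff -> : (n%:Z - k * i.+1%:Z)%:~R / m.+1%:Q * 'C(m.+1, i.+1)%:R
  = ('C(m.+1, i.+1)%:Z + (1 - k) * 'C(m, i)%:Z)%:~R :> rat by exact: intr_int.
have -> : n%:Z - k * i.+1%:Z = m.+1%:Z + (1 - k) * i.+1%:Z.
  by rewrite mulrBl mul1r /m; lia.
apply: (mulfI nz_m); rewrite !intrD !intrM mulrDr mulrA mulrCA divff // mulr1.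
by rewrite mulrDl -mulrA binE mulrCA.
Qed.

(* By rdickson_coef_int the coefficients occurring here are integers, so numq
   extracts their value; %:~R then reduces it modulo the characteristic. *)
Definition rdickson (R : nzRingType) (n : nat) (k : int) (a : R) : {poly R} :=
  if n == 0%N then (2 - k)%:~R%:P
  else \sum_(i < n./2.+1)
         ((numq (rdickson_coef n k i))%:~R * a ^+ (n - 2 * i)) *: (- 'X) ^+ i.

Definition permutation_poly (F : finFieldType) (f : {poly F}) : Prop :=
  bijective (fun x : F => f.[x]).

(* Main.v *)
(* At a = 0 only the term with n = 2 i survives, so D_{n,k}(0, x) is zero for
   odd n and (2 - k) (-x)^l for n = 2 l > 0.  The scalar 2 - k vanishes mod p
   only when k = 2, because 3 - p <= 2 - k <= 2, and x^l permutes F_q exactly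
   when l is coprime to q - 1. *)
Require Import Defs.
From mathcomp Require Import all_boot all_order all_algebra all_field.
From mathcomp Require Import zify.

Set Implicit Arguments.
Unset Strict Implicit.
Unset Printing Implicit Defensive.

Import Order.TTheory GRing.Theory Num.Theory.
Local Open Scope ring_scope.

Lemma rdickson0_odd (R : nzRingType) (n : nat) (k : int) :
  odd n -> rdickson n k (0 : R) = 0.
Proof.
move=> n_odd; rewrite /rdickson ifF; last by case: n n_odd.
apply: big1 => i _; have lt_in := ltn_ord i.
(* By parity the exponent of [a = 0] never vanishes, so [0 ^+ 0 = 1] does not occur. *)
have /negPf n2i_neq0 : (n - 2 * i != 0)%N by lia.
by rewrite expr0n n2i_neq0 mulr0 scale0r.
Qed.

Lemma rdickson0_double (R : nzRingType) (l : nat) (k : int) :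
  rdickson (2 * l) k (0 : R) = (2 - k)%:~R *: (- 'X) ^+ l.
Proof.
(* For [l = 0] the separate value [2 - k] given to [n = 0] fits the same formula. *)
have [->|l_gt0] := posnP l; first by rewrite muln0 /rdickson expr0 alg_polyC.
have half_2l : (2 * l)./2 = l by lia.
rewrite /rdickson ifF ?half_2l; last by lia.
rewrite big_ord_recr big1 /= => [|i _]; last first.
  have lt_il := ltn_ord i.
  have /negPf l2i_neq0 : (2 * l - 2 * i != 0)%N by lia.
  by rewrite expr0n l2i_neq0 mulr0 scale0r.
rewrite add0r subnn expr0 mulr1.
(* The top coefficient is (2l - kl)/(2l - l) times C(l, l) = 1. *)
suff -> : rdickson_coef (2 * l) k l = (2 - k)%:~R by rewrite numq_int.
rewrite /rdickson_coef.
have -> : (2 * l - l = l)%N by lia.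
have -> : (2 * l)%:Z - k * l%:Z = (2 - k) * l%:Z by rewrite mulrBl PoszM.
have -> : (2 * l)%:Z - l%:Z = l%:Z by lia.
by rewrite binn mulr1 intrM mulfK // intr_eq0; lia.
Qed.

Lemma expf_bijP (F : finFieldType) (l : nat) : (0 < l)%N ->
  bijective (fun x : F => x ^+ l) <-> coprime l #|F|.-1.
Proof.
move=> l_gt0; have F_gt1 : (1 < #|F|)%N := finNzRing_gt1 F.
have unitX (x : F) : x != 0 -> x ^+ #|F|.-1 = 1.
  move=> x_neq0; apply: (mulfI x_neq0).
  by rewrite mulr1 -exprS prednK ?expf_card //; lia.
split=> [/bij_inj inj_l | co_l].
  (* With d := gcd(l, q - 1), every x^((q-1)/d) with x != 0 has l-th power 1,
     hence equals 1; too many roots for 'X^((q-1)/d) - 1 unless d = 1. *)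
  set d := gcdn l #|F|.-1; set m := (#|F|.-1 %/ d)%N.
  have d_gt0 : (0 < d)%N by rewrite gcdn_gt0 l_gt0.
  have mdE : (m * d = #|F|.-1)%N by rewrite divnK ?dvdn_gcdr.
  have m_gt0 : (0 < m)%N by case: m mdE => //; lia.
  have root1 (x : F) : x != 0 -> x ^+ m = 1.
    move=> x_neq0; apply: inj_l.
    rewrite -exprM -(divnK (dvdn_gcdl l #|F|.-1)) -/d [(_ %/ _ * d)%N]mulnC.
    by rewrite mulnA mdE exprM unitX // !expr1n.
  have : (size (enum (predC1 (0%R : F))) <= m)%N.
    apply: max_unity_roots; rewrite ?enum_uniq //.
    by apply/allP => x; rewrite mem_enum => /root1 /eqP; rewrite unity_rootE.
  rewrite -cardE cardC1 -mdE -[X in (_ <= X)%N]muln1 leq_pmul2l // => d_le1.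
  by rewrite /coprime mdE -/d eqn_leq d_le1.
apply: injF_bij => x y /= eq_xy.
have xy0 : (x == 0) = (y == 0).
  by have := congr1 (eq_op^~ 0) eq_xy; rewrite /= !expf_eq0 l_gt0.
have [x0 | x_neq0] := eqVneq x 0.
  by move: xy0; rewrite x0 eqxx => /esym/eqP ->.
have y_neq0 : y != 0 by rewrite -xy0.
(* Bezout gives u l = v (q - 1) + 1, so z -> z^u undoes z -> z^l on nonzero elements. *)
case: (egcdnP #|F|.-1 l_gt0) => u v; rewrite (eqP co_l) => uvE _.
have invX (z : F) : z != 0 -> z = z ^+ l ^+ u.
  move=> z_neq0; rewrite -exprM mulnC uvE exprD mulnC exprM unitX //.
  by rewrite expr1n mul1r.
by rewrite (invX x) // (invX y) // eq_xy.
Qed.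

(** A natural number maps to 0 only if p divides it, and 0 < |z| < p rules this out; the sign of z
    does not affect vanishing. Serves for the scalar [2 - k]. *)
Lemma intr_neq0_pchar (R : nzRingType) (p : nat) (z : int) :
  p \in [pchar R] -> z != 0 -> (absz z < p)%N -> z%:~R != 0 :> R.
Proof.
move=> pchar_p z_neq0 lt_zp.
have : `|z|%N%:R != 0 :> R.
  rewrite -(dvdn_pcharf pchar_p); apply: contraL lt_zp => /dvdn_leq.
  by rewrite absz_gt0 z_neq0 -leqNgt; apply.
by case: z {z_neq0 lt_zp} => m //; rewrite NegzE mulrNz oppr_eq0 abszN.
Qed.

(** The two maps differ by the bijections x -> -x and y -> c y; over a finite field it suffices to
    transfer injectivity. *)
Lemma horner_scale_opp_exp_bij (F : finFieldType) (c : F) (l : nat) : c != 0 ->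
  bijective (fun x : F => (c *: (- 'X) ^+ l).[x]) <->
  bijective (fun x : F => x ^+ l).
Proof.
move=> c_neq0.
have hornerE' (x : F) : (c *: (- 'X) ^+ l).[x] = c * (- x) ^+ l.
  by rewrite hornerZ horner_exp hornerN hornerX.
split=> /bij_inj inj_f; apply: injF_bij => x y /=.
  by move=> eq_xy; apply/oppr_inj/inj_f; rewrite !hornerE' !opprK eq_xy.
by rewrite !hornerE' => /(mulfI c_neq0) /inj_f /oppr_inj.
Qed.

Lemma constant_not_bij (R : nzRingType) (f : R -> R) (c : R) :
  (forall x, f x = c) -> ~ bijective f.
Proof.
move=> fE /bij_inj inj_f; have := inj_f 0 1; rewrite !fE => /(_ erefl) /eqP.
by rewrite eq_sym oner_eq0.
Qed.

Theorem theorem2p1 (p e q : nat) (F : finFieldType) (k : int) (n : nat)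
    (hp : prime p) (hodd : odd p) (hq : q = (p ^ e)%N) (hF : #|F| = q)
    (hk : 0 <= k <= p%:Z - 1) :
  permutation_poly (rdickson n k (0 : F)) <->
  k <> 2 /\ exists l : nat, n = (2 * l)%N /\ gcdn l (q - 1) = 1%N.
Proof.
have q_gt2 : (2 < q)%N.
  have q_odd : odd q by rewrite hq oddX hodd orbT.
  have : (1 < #|F|)%N := finNzRing_gt1 F.
  by rewrite hF; lia.
have pchar_p : p \in [pchar F] by apply: (@card_finPcharP _ _ e); rewrite ?hF.
have scal_neq0 : k <> 2 -> (2 - k)%:~R != 0 :> F.
  have := prime_gt1 hp.
  by move=> p_gt1 k_neq2; apply: (intr_neq0_pchar pchar_p); lia.
have coprimeE l : coprime l #|F|.-1 = (gcdn l (q - 1) == 1)%N.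
  by rewrite hF -subn1.
rewrite /permutation_poly; split=> [bij_f | [k_neq2 [l [-> /eqP co_l]]]].
  have n_even : ~~ odd n.
    apply/negP => n_odd; case: (@constant_not_bij _ _ 0 _ bij_f) => x.
    by rewrite rdickson0_odd ?horner0.
  have nE : n = (2 * n./2)%N by lia.
  move: bij_f; rewrite {1}nE rdickson0_double => bij_f.
  have k_neq2 : k <> 2.
    move=> k2; case: (@constant_not_bij _ _ 0 _ bij_f) => x.
    by rewrite k2 subrr scale0r horner0.
  move: bij_f => /(horner_scale_opp_exp_bij _ (scal_neq0 k_neq2)) bij_X.
  split=> //; exists n./2; split=> //; apply/eqP; rewrite -coprimeE.
  (* If l = 0, the power map is constantly 1. *)
  apply/expf_bijP => //; rewrite lt0n; apply/eqP => l0.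
  by case: (@constant_not_bij _ _ 1 _ bij_X) => x; rewrite l0.
(* Here q > 2 matters: l = 0 would give gcd(0, q - 1) = q - 1 > 1. *)
have l_gt0 : (0 < l)%N.
  by case: l co_l => //; rewrite gcd0n; lia.
rewrite rdickson0_double; apply/horner_scale_opp_exp_bij; first exact: scal_neq0.
by apply/expf_bijP => //; rewrite coprimeE.
Qed.
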